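(* For every integer $n>0$, the poset $\mathcal{R}(n)$, ordered by inclusion, has exactly $2n$ coatoms. These are the elements $\mathcal{Q}(n)\setminus\mathtt{C}(n,k)$ and $\mathcal{Q}(n)\setminus\mathtt{R}(n,k)$, for $k=1,2,\dots,n$, where $$\mathtt{C}(n,k)=\{(k,0),(k,1),\dots,(k,n-k)\},\qquad \mathtt{R}(n,k)=\{(0,k),(1,k),\dots,(n-k,k)\}.$$
   Context: For an integer $n\ge 0$, let $\mathcal{Q}(n)=\{(x,y)\in\mathbb{Z}^2: 0\le x,\ 0\le y,\ x+y\le n\}$. Let $\mathcal{R}(n)$ be the set of all subsets $Y\subseteq\mathcal{Q}(n)$ such that: for any $(a,b),(c,d)\in Y$ with $\max(a,c)+\max(b,d)\le n+1$, we have $(\min(a,c),\min(b,d))\in Y$ and, additionally, $(\max(a,c),\max(b,d))\in Y$ as soon as $(\max(a,c),\max(b,d))\in\mathcal{Q}(n)$. The poset $\mathcal{R}(n)$ has maximum element $\mathcal{Q}(n)$; a coatom is a maximal element among those different from $\mathcal{Q}(n)$. *)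

(* Defs.v *)
From mathcomp Require Import all_boot all_order.

Set Implicit Arguments.
Unset Strict Implicit.
Unset Printing Implicit Defensive.

(* Every lattice point under consideration has both coordinates in {0, ..., n};
   this box is closed under componentwise minimum and maximum. *)
Notation point n := ('I_n.+1 * 'I_n.+1)%type.

Definition Q (n : nat) : {set point n} := [set p : point n | p.1 + p.2 <= n].

Definition pmin (n : nat) (p q : point n) : point n :=
  (Order.min p.1 q.1, Order.min p.2 q.2).

Definition pmax (n : nat) (p q : point n) : point n :=
  (Order.max p.1 q.1, Order.max p.2 q.2).

(* The hypothesis on the maxima allows the value n + 1, in which case
   pmax p q lies just outside Q n and only the minimum is required. *)
Definition calR (n : nat) : {set {set point n}} :=
  [set Y : {set point n} | (Y \subset Q n) &&
    [forall p : point n in Y, forall q : point n in Y,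
      ((pmax p q).1 + (pmax p q).2 <= n.+1) ==>
        (pmin p q \in Y) && ((pmax p q \in Q n) ==> (pmax p q \in Y))]].

Definition coatoms (n : nat) : {set {set point n}} :=
  [set Y | maxset (fun Z : {set point n} => (Z \in calR n) && (Z != Q n)) Y].

Definition colC (n k : nat) : {set point n} :=
  [set p : point n | (p.1 == k :> nat) && (p.2 <= n - k)].

Definition rowR (n k : nat) : {set point n} :=
  [set p : point n | (p.1 <= n - k) && (p.2 == k :> nat)].

(* Main.v *)
Require Import Defs.
From mathcomp Require Import all_boot all_order zify.

(** Let [Y] in [calR n] meet every column and every row of positive index. The
    point of [Y] in column [k] and the one in row [n - k] have maximum
    [(k, n - k)], so [Y] contains the whole diagonal [x + y = n]. Two
    neighbours on the diagonal [x + y = m + 1] have a maximum of coordinate sum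
    [m + 2 <= n + 1], so their minimum, an arbitrary point of [x + y = m], is
    in [Y] as well, and descending on [m] gives [Y = Q n]. Hence every proper
    element of [calR n] avoids a column or a row, and no column or row of
    positive index contains another one. *)

Lemma val_min_ord (n : nat) (i j : 'I_n) : Order.min i j = minn i j :> nat.
Proof. by case: Order.TotalTheory.leP; rewrite ?leEord ?ltEord /=; lia. Qed.

Lemma val_max_ord (n : nat) (i j : 'I_n) : Order.max i j = maxn i j :> nat.
Proof. by case: Order.TotalTheory.leP; rewrite ?leEord ?ltEord /=; lia. Qed.

Lemma point_inj (n : nat) (p q : point n) :
  p.1 = q.1 :> nat -> p.2 = q.2 :> nat -> p = q.
Proof.
by case: p q => [a b] [c d] /= ac bd; congr pair; apply: val_inj.
Qed.

Lemma calRP (n : nat) (Y : {set point n}) :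
  reflect
    (Y \subset Q n /\
     forall p q, p \in Y -> q \in Y ->
       maxn p.1 q.1 + maxn p.2 q.2 <= n.+1 ->
       pmin p q \in Y /\ (maxn p.1 q.1 + maxn p.2 q.2 <= n -> pmax p q \in Y))
    (Y \in calR n).
Proof.
rewrite inE; apply: (iffP andP) => -[YQ clY]; split=> //.
  move=> p q pY qY le_n1.
  move/forall_inP/(_ p pY)/forall_inP/(_ q qY)/implyP: clY.
  rewrite inE /= !val_max_ord => /(_ le_n1) /andP[-> /implyP clY].
  by split.
apply/forall_inP=> p pY; apply/forall_inP=> q qY; apply/implyP.
rewrite inE /= !val_max_ord => /(clY p q pY qY)[-> clY'].
exact/implyP.
Qed.

Section Lines.
Variable n : nat.
Implicit Types (Y : {set point n}) (u v : 'I_n + 'I_n).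

(** Shifting the index by one makes ['I_n + 'I_n] enumerate exactly the columns and rows of positive
    index, which is where the count 2n comes from. *)
Definition line u : {set point n} :=
  match u with inl k => colC n k.+1 | inr k => rowR n k.+1 end.

Lemma line_subQ u : line u \subset Q n.
Proof.
by apply/subsetP=> -[a b]; case: u => k; rewrite !inE /=; have := ltn_ord k; lia.
Qed.

(** Each line is recognised by its end on an axis: (k + 1, 0) lies on no row of positive index and
    on no other column, and symmetrically for (0, k + 1). *)
Lemma subset_line u v : line u \subset line v -> u = v.
Proof.
move=> /subsetP uv.
have ko (k : 'I_n) : k.+1 < n.+1 := ltn_ord k.
case: u v uv => k [] l uv.
- have := uv (Ordinal (ko k), ord0); rewrite !inE /= eqxx => /(_ isT).
  by case/andP=> /eqP[kl] _; congr inl; apply: val_inj.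
- by have := uv (Ordinal (ko k), ord0); rewrite !inE /= eqxx andbF => /(_ isT).
- by have := uv (ord0, Ordinal (ko k)); rewrite !inE /= eqxx => /(_ isT).
- have := uv (ord0, Ordinal (ko k)); rewrite !inE /= eqxx => /(_ isT).
  by move=> /eqP[kl]; congr inr; apply: val_inj.
Qed.

Lemma line_neq0 u : line u != set0.
Proof.
have ko (k : 'I_n) : k.+1 < n.+1 := ltn_ord k.
apply/set0Pn; case: u => k.
  by exists (Ordinal (ko k), ord0); rewrite !inE /= eqxx.
by exists (ord0, Ordinal (ko k)); rewrite !inE /= eqxx.
Qed.

(** A column consists of all points of [Q n] with a given first coordinate. The first coordinate of
    a minimum or maximum is that of one of the two points, so avoiding that value is preserved;
    likewise for rows. *)
Lemma setD_line_calR u : Q n :\: line u \in calR n.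
Proof.
apply/calRP; split=> [|[a b] [c d]]; first exact: subsetDl.
case: u => k; rewrite !inE /= !val_min_ord !val_max_ord; have := ltn_ord k; lia.
Qed.

Lemma calR_meets_lines Y :
  0 < n -> Y \in calR n -> (forall u, ~~ [disjoint Y & line u]) -> Y = Q n.
Proof.
move=> n_gt0 /calRP[YQ clY] meets.
have inQ (a b : 'I_n.+1) : (a, b) \in Y -> a + b <= n.
  by move=> /(subsetP YQ); rewrite inE.
have col (a : 'I_n.+1) : 0 < a -> exists b : 'I_n.+1, (a, b) \in Y.
  move=> a_gt0; have a_n : a.-1 < n by have := ltn_ord a; lia.
  have /pred0Pn[[c b] /andP[/= cbY]] := meets (inl (Ordinal a_n)).
  rewrite inE /= prednK // => /andP[/eqP ca _].
  by exists b; rewrite -(val_inj ca : c = a).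
have row (b : 'I_n.+1) : 0 < b -> exists a : 'I_n.+1, (a, b) \in Y.
  move=> b_gt0; have b_n : b.-1 < n by have := ltn_ord b; lia.
  have /pred0Pn[[a c] /andP[/= acY]] := meets (inr (Ordinal b_n)).
  rewrite inE /= prednK // => /andP[_ /eqP cb].
  by exists a; rewrite -(val_inj cb : c = b).
have diag d : d <= n -> forall a b : 'I_n.+1, a + b = n - d -> (a, b) \in Y.
  elim: d => [|d IHd] d_le a b ab_d.
    (* The ends of the diagonal need a single line: if a = 0 then b = n > 0, and (0, n) is the only
       point of [Q n] in row n. *)
    have [a0|a_gt0] := posnP a.
      have [|c cbY] := row b; first by lia.
      by have <- : c = a by apply: val_inj => /=; have := inQ c b cbY; lia.
    have [c acY] := col a a_gt0; have := inQ a c acY => ac_le.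
    have [b0|b_gt0] := posnP b.
      by have <- : c = b by apply: val_inj => /=; lia.
    have [e ebY] := row b b_gt0; have := inQ e b ebY => eb_le.
    (* As a + b = n, membership in [Q n] forces c <= b and e <= a. *)
    have [|_ /=] := clY _ _ acY ebY; first by move=> /=; lia.
    have -> : pmax (a, c) (e, b) = (a, b).
      by apply: point_inj; rewrite /= val_max_ord; lia.
    by apply; lia.
  have a_n : a.+1 < n.+1 by lia.
  have b_n : b.+1 < n.+1 by lia.
  have rightY : (Ordinal a_n, b) \in Y by apply: IHd => /=; lia.
  have upY : (a, Ordinal b_n) \in Y by apply: IHd => /=; lia.
  (* The maximum has coordinate sum n - d + 1. For d = 0 this is n + 1: the maximum leaves [Q n],
     yet the minimum is still granted. *)
  have [|+ _] := clY _ _ rightY upY; first by move=> /=; lia.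
  have -> // : pmin (Ordinal a_n, b) (a, Ordinal b_n) = (a, b).
  by apply: point_inj; rewrite /= val_min_ord /=; lia.
apply/eqP; rewrite eqEsubset YQ; apply/subsetP=> -[a b]; rewrite inE /= => ab_le.
by apply: (diag (n - (a + b))); lia.
Qed.

Lemma calR_sub_setD_line Y :
  0 < n -> Y \in calR n -> Y != Q n -> exists u, Y \subset Q n :\: line u.
Proof.
move=> n_gt0 YR; case: (pickP (fun u => [disjoint Y & line u])) => [u Yu _|meets].
  by exists u; rewrite subsetD Yu; have /calRP[->] := YR.
by rewrite (calR_meets_lines Y n_gt0 YR) ?eqxx // => u; rewrite meets.
Qed.

Lemma setD_line_subset u v :
  (Q n :\: line u \subset Q n :\: line v) = (line v \subset line u).
Proof.
apply/idP/idP=> [uv|vu]; last exact: setDS.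
(* Complementing twice in [Q n] gives each line back. *)
by have := setDS (Q n) uv; rewrite !setDDr !setDv !set0U;
  rewrite !(setIidPr (line_subQ _)).
Qed.

Lemma setD_line_neq u : Q n :\: line u != Q n.
Proof.
apply: contra (line_neq0 u) => /eqP /setDidPl.
by rewrite -setI_eq0 (setIidPr (line_subQ u)).
Qed.

Lemma coatomsE : 0 < n -> coatoms n = [set Q n :\: line u | u : 'I_n + 'I_n].
Proof.
move=> n_gt0; apply/setP=> Y; rewrite inE; apply/maxsetP/imsetP.
  case=> /andP[YR YQ] maxY.
  have [u Yu] := calR_sub_setD_line Y n_gt0 YR YQ.
  by exists u; rewrite // (maxY _ _ Yu) // setD_line_calR setD_line_neq.
case=> u _ ->; rewrite setD_line_calR setD_line_neq; split=> // Z /andP[ZR ZQ] uZ.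
have [v Zv] := calR_sub_setD_line Z n_gt0 ZR ZQ.
(* [Z] is squeezed between the complements of two lines, which must coincide because no line
   contains another. *)
have := subset_trans uZ Zv; rewrite setD_line_subset => /subset_line vu.
by apply/eqP; rewrite eqEsubset uZ -{1}vu Zv.
Qed.

End Lines.

Theorem proposition25 (n : nat) (n_gt0 : 0 < n) :
  #|coatoms n| = 2 * n /\
  (forall Y : {set point n},
     Y \in coatoms n <->
     exists k : nat, 1 <= k <= n /\
       (Y = Q n :\: colC n k \/ Y = Q n :\: rowR n k)).
Proof.
rewrite coatomsE //; split.
  rewrite card_imset ?card_sum ?card_ord ?addnn ?mul2n // => u v /eqP.
  by rewrite eqEsubset !setD_line_subset => /andP[_ /subset_line].
move=> Y; split=> [/imsetP[[k|k] _ ->]|[[|k] [// k_le [] ->]]].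
- by exists k.+1; split; [exact: ltn_ord | left].
- by exists k.+1; split; [exact: ltn_ord | right].
- by apply/imsetP; exists (inl (Ordinal k_le)).
- by apply/imsetP; exists (inr (Ordinal k_le)).
Qed.
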